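(* Let $v\in\mathfrak{S}_n$ be a $321$-avoiding and $2$-repeating permutation. Then $$\tilde{R}_{e,v}(t)=t^{n_v^1}\prod_{i=1}^{\kappa(v)}\mathcal{F}_{\lambda_i}(t).$$
   Context: $\mathfrak{S}_n$ has Coxeter generators $s_i=(i,i+1)$, $1\le i<n$. A permutation is $321$-avoiding if no reduced expression of it contains a subword of consecutive letters of the form $s_is_{i\pm1}s_i$; then the number $n_v(i)$ of occurrences of $s_i$ in a reduced expression of $v$ is independent of the expression, and $v$ is $2$-repeating if $n_v(i)\le2$ for all $i$. Let $n_v^1$ be the number of $i$ with $n_v(i)=1$. A $2$-chain of $v$ is a maximal set of consecutive integers $\{a,a+1,\dots,b\}$ with $n_v(i)=2$ for all $a\le i\le b$ (i.e. $n_v(a-1)\neq2$ and $n_v(b+1)\neq 2$). Let $\kappa(v)$ be the number of $2$-chains, $c_1,\dots,c_{\kappa(v)}$ the $2$-chains ordered increasingly, and $\lambda_i=|c_i|$. Fibonacci polynomials: $F_0=1$, $F_1(t)=t$, $F_m=tF_{m-1}+F_{m-2}$; modified Fibonacci polynomials $\mathcal{F}_m(t)=t^{m-1}F_{m+1}(t)$ for $m\ge1$. Hecke algebra: generated over $\mathbb{Z}[t,t^{-1}]$ by $H_s$ with $H_s^2=1+(t^{-1}-t)H_s$ and braid relations; $H_w=H_{s_{i_1}}\cdots H_{s_{i_k}}$ for a reduced expression; $R_{u,w}$ is defined by $(H_{w^{-1}})^{-1}=\sum_u R_{u,w}(t)H_u$, and $\tilde{R}_{u,w}\in\mathbb{N}[t]$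 is the unique polynomial with $R_{u,w}(t)=\tilde{R}_{u,w}(t-t^{-1})$. *)

(* Defs.v *)
From HB Require Import structures.
From mathcomp Require Import all_boot all_order all_algebra all_fingroup.
From mathcomp Require Import generic_quotient boolp.
From mathcomp Require classical_sets.

Set Implicit Arguments.
Unset Strict Implicit.
Unset Printing Implicit Defensive.

Import GRing.Theory.
Local Open Scope ring_scope.
Local Open Scope quotient_scope.

(* Both the points permuted and the generators are numbered from 0: for
   k : 'I_n.-1, [sref k] is the adjacent transposition of the points k and
   k + 1 of 'I_n, usually written s_(k+1). *)
Lemma sref_lo_proof (n : nat) (k : 'I_n.-1) : (k < n)%N.
Proof. exact: leq_trans (ltn_ord k) (leq_pred n). Qed.

Lemma sref_hi_proof (n : nat) (k : 'I_n.-1) : (k.+1 < n)%N.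
Proof. by case: n k => [|n] [k lt_k]. Qed.

Definition sref (n : nat) (k : 'I_n.-1) : 'S_n :=
  tperm (Ordinal (sref_lo_proof k)) (Ordinal (sref_hi_proof k)).

Definition word_perm (n : nat) (s : seq 'I_n.-1) : 'S_n :=
  (\prod_(k <- s) sref k)%g.

Definition reduced_expr (n : nat) (v : 'S_n) (s : seq 'I_n.-1) : Prop :=
  word_perm s = v /\
  forall s' : seq 'I_n.-1, word_perm s' = v -> (size s <= size s')%N.

Definition red_word (n : nat) (v : 'S_n) : seq 'I_n.-1 :=
  classical_sets.xget [::] (reduced_expr v).

Definition avoids321 (n : nat) (v : 'S_n) : Prop :=
  forall s : seq 'I_n.-1, reduced_expr v s ->
  forall i j : 'I_n.-1, j = i.+1 :> nat \/ i = j.+1 :> nat ->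
  ~~ infix [:: i; j; i] s.

(* Independent of the chosen reduced expression when v is 321-avoiding. *)
Definition nocc (n : nat) (v : 'S_n) (i : 'I_n.-1) : nat :=
  count_mem i (red_word v).

Definition two_repeating (n : nat) (v : 'S_n) : Prop :=
  forall i : 'I_n.-1, (nocc v i <= 2)%N.

Definition nocc1 (n : nat) (v : 'S_n) : nat := #|[set i | nocc v i == 1%N]|.

Definition consecutive (m : nat) (c : {set 'I_m}) : bool :=
  [exists a : 'I_m, exists b : 'I_m,
    (a <= b)%N && (c == [set i : 'I_m | (a <= i <= b)%N])].

Definition two_chains (n : nat) (v : 'S_n) : {set {set 'I_n.-1}} :=
  [set c | maxset (fun d : {set 'I_n.-1} =>
                     consecutive d && [forall i in d, nocc v i == 2%N]) c].

Fixpoint Fib (m : nat) : {poly nat} :=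
  match m with
  | 0 => 1
  | 1 => 'X
  | (m''.+1 as m').+1 => 'X * Fib m' + Fib m''
  end.

Definition modFib (m : nat) : {poly nat} := 'X^(m.-1) * Fib m.+1.

(* Z[t, t^-1] is realized inside the fraction field of Z[t]. *)
Definition is_laurent : {pred {fraction {poly int}}} :=
  fun x => `[< exists p : {poly int}, exists k : nat,
                 x = FracField.tofrac p / FracField.tofrac 'X ^+ k >].

Local Notation tF := (FracField.tofrac ('X : {poly int})).

Lemma tF_neq0 : tF != 0.
Proof. by rewrite tofrac_eq0 polyX_eq0. Qed.

Lemma is_laurent_subring : subring_closed is_laurent.
Proof.
have t0 k : tF ^+ k != 0 by rewrite expf_neq0 ?tF_neq0.
split.
- by apply/asboolP; exists 1, 0%N; rewrite expr0 divr1 tofrac1.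
- move=> _ _ /asboolP[p [k ->]] /asboolP[q [l ->]]; apply/asboolP.
  exists (p * 'X ^+ l - q * 'X ^+ k), (k + l)%N.
  by rewrite -mulNr addf_div // tofracB !tofracM !tofracXn exprD mulNr.
- move=> _ _ /asboolP[p [k ->]] /asboolP[q [l ->]]; apply/asboolP.
  by exists (p * q), (k + l)%N; rewrite mulf_div tofracM exprD.
Qed.

HB.instance Definition _ :=
  GRing.isSubringClosed.Build {fraction {poly int}} is_laurent
    is_laurent_subring.

Record laurent : predArgType :=
  Laurent { laurent_val : {fraction {poly int}};
            laurentP : laurent_val \in is_laurent }.

HB.instance Definition _ := [isSub for laurent_val].
HB.instance Definition _ := [Choice of laurent by <:].
HB.instance Definition _ := [SubChoice_isSubComNzRing of laurent by <:].

Lemma laurent_t_proof : tF \in is_laurent.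
Proof. by apply/asboolP; exists 'X, 0%N; rewrite expr0 divr1. Qed.

Lemma laurent_tV_proof : tF^-1 \in is_laurent.
Proof. by apply/asboolP; exists 1, 1%N; rewrite expr1 tofrac1 mul1r. Qed.

Definition laurent_t : laurent := Laurent laurent_t_proof.
Definition laurent_tV : laurent := Laurent laurent_tV_proof.

Lemma laurent_t_tV : laurent_t * laurent_tV = 1.
Proof. by apply: val_inj; rewrite /= divff ?tF_neq0. Qed.

Inductive hterm (n : nat) : Type :=
| HCst of laurent
| HGen of 'I_n.-1
| HAdd of hterm n & hterm n
| HMul of hterm n & hterm n.

Arguments HCst {n}.

HB.instance Definition _ (n : nat) := gen_eqMixin (hterm n).
HB.instance Definition _ (n : nat) := gen_choiceMixin (hterm n).

(* The least congruence for which terms form a laurent-algebra and the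
   generators satisfy the Hecke relations. *)
Inductive heq (n : nat) : hterm n -> hterm n -> Prop :=
| heq_refl x : heq x x
| heq_sym x y : heq x y -> heq y x
| heq_trans x y z : heq x y -> heq y z -> heq x z
| heq_add x x' y y' : heq x x' -> heq y y' -> heq (HAdd x y) (HAdd x' y')
| heq_mul x x' y y' : heq x x' -> heq y y' -> heq (HMul x y) (HMul x' y')
| heq_addA x y z : heq (HAdd x (HAdd y z)) (HAdd (HAdd x y) z)
| heq_addC x y : heq (HAdd x y) (HAdd y x)
| heq_add0 x : heq (HAdd (HCst 0) x) x
| heq_addN x : heq (HAdd (HMul (HCst (-1)) x) x) (HCst 0)
| heq_mulA x y z : heq (HMul x (HMul y z)) (HMul (HMul x y) z)
| heq_mul1l x : heq (HMul (HCst 1) x) x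
| heq_mulDl x y z : heq (HMul (HAdd x y) z) (HAdd (HMul x z) (HMul y z))
| heq_mulDr x y z : heq (HMul x (HAdd y z)) (HAdd (HMul x y) (HMul x z))
| heq_cstD a b : heq (HCst (a + b)) (HAdd (HCst a) (HCst b))
| heq_cstM a b : heq (HCst (a * b)) (HMul (HCst a) (HCst b))
| heq_cstC a x : heq (HMul (HCst a) x) (HMul x (HCst a))
| heq_quad (i : 'I_n.-1) :
    heq (HMul (HGen i) (HGen i))
        (HAdd (HCst 1) (HMul (HCst (laurent_tV - laurent_t)) (HGen i)))
| heq_braid (i j : 'I_n.-1) : j = i.+1 :> nat ->
    heq (HMul (HMul (HGen i) (HGen j)) (HGen i))
        (HMul (HMul (HGen j) (HGen i)) (HGen j))
| heq_comm (i j : 'I_n.-1) : (i.+1 < j)%N ->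
    heq (HMul (HGen i) (HGen j)) (HMul (HGen j) (HGen i)).

Definition heqb (n : nat) (x y : hterm n) : bool := `[< heq x y >].

Lemma heqb_refl n : reflexive (@heqb n).
Proof. by move=> x; apply/asboolP; exact: heq_refl. Qed.

Lemma heqb_sym n : symmetric (@heqb n).
Proof.
by move=> x y; apply/asboolP/asboolP; exact: heq_sym.
Qed.

Lemma heqb_trans n : transitive (@heqb n).
Proof.
by move=> y x z /asboolP xy /asboolP yz; apply/asboolP; exact: heq_trans xy yz.
Qed.

Canonical heqb_equiv (n : nat) :=
  EquivRel (@heqb n) (@heqb_refl n) (@heqb_sym n) (@heqb_trans n).

Definition hecke (n : nat) : Type := {eq_quot (@heqb n)}.

HB.instance Definition _ (n : nat) := Choice.on (hecke n).
HB.instance Definition _ (n : nat) := EqQuotient.on (hecke n).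

Section HeckeRing.
Variable n : nat.
Implicit Types x y z : hecke n.

Lemma hpiP (x y : hterm n) : heq x y <-> \pi_(hecke n) x = \pi_(hecke n) y.
Proof. by split=> [h|/eqmodP/asboolP//]; apply/eqmodP/asboolP. Qed.

Definition hcst (a : laurent) : hecke n := \pi_(hecke n) (HCst a).
Definition hadd x y : hecke n := \pi_(hecke n) (HAdd (repr x) (repr y)).
Definition hmul x y : hecke n := \pi_(hecke n) (HMul (repr x) (repr y)).
Definition hopp x : hecke n := hmul (hcst (-1)) x.
Definition hscale (a : laurent) x : hecke n := hmul (hcst a) x.

Lemma pi_hadd (x y : hterm n) :
  hadd (\pi_(hecke n) x) (\pi_(hecke n) y) = \pi_(hecke n) (HAdd x y).
Proof. by apply/hpiP/heq_add; apply/hpiP; rewrite reprK. Qed.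

Lemma pi_hmul (x y : hterm n) :
  hmul (\pi_(hecke n) x) (\pi_(hecke n) y) = \pi_(hecke n) (HMul x y).
Proof. by apply/hpiP/heq_mul; apply/hpiP; rewrite reprK. Qed.

(* The one-dimensional representation H_s |-> t^-1; it shows that 1 != 0. *)
Fixpoint hchar (x : hterm n) : laurent :=
  match x with
  | HCst a => a
  | HGen _ => laurent_tV
  | HAdd x y => hchar x + hchar y
  | HMul x y => hchar x * hchar y
  end.

Lemma heq_hchar (x y : hterm n) : heq x y -> hchar x = hchar y.
Proof.
elim=> //=.
- by move=> ? ? ? _ -> _ ->.
- by move=> ? ? ? ? _ -> _ ->.
- by move=> ? ? ? ? _ -> _ ->.
- by move=> ? ? ?; rewrite addrA.
- by move=> ? ?; rewrite addrC.
- by move=> ?; rewrite add0r.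
- by move=> ?; rewrite mulN1r addNr.
- by move=> ? ? ?; rewrite mulrA.
- by move=> ?; rewrite mul1r.
- by move=> ? ? ?; rewrite mulrDl.
- by move=> ? ? ?; rewrite mulrDr.
- by move=> ? ?; rewrite mulrC.
- by move=> _; rewrite mulrBl laurent_t_tV addrC subrK.
Qed.

Let piE := (pi_hadd, pi_hmul).

Lemma haddA : associative hadd.
Proof.
elim/quotW=> x; elim/quotW=> y; elim/quotW=> z.
by rewrite (pi_hadd y z) (pi_hadd x y) !piE; apply/hpiP; exact: heq_addA.
Qed.

Lemma haddC : commutative hadd.
Proof.
by elim/quotW=> x; elim/quotW=> y; rewrite !piE; apply/hpiP; exact: heq_addC.
Qed.

Lemma hadd0 : left_id (hcst 0) hadd.
Proof. by elim/quotW=> x; rewrite !piE; apply/hpiP; exact: heq_add0. Qed.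

Lemma hmulA : associative hmul.
Proof.
elim/quotW=> x; elim/quotW=> y; elim/quotW=> z.
by rewrite (pi_hmul y z) (pi_hmul x y) !piE; apply/hpiP; exact: heq_mulA.
Qed.

Lemma hmul1l : left_id (hcst 1) hmul.
Proof. by elim/quotW=> x; rewrite !piE; apply/hpiP; exact: heq_mul1l. Qed.

Lemma hcstC a x : hmul (hcst a) x = hmul x (hcst a).
Proof. by elim/quotW: x => x; rewrite !piE; apply/hpiP; exact: heq_cstC. Qed.

Lemma hmul1r : right_id (hcst 1) hmul.
Proof. by move=> x; rewrite -hcstC hmul1l. Qed.

Lemma hmulDl : left_distributive hmul hadd.
Proof.
elim/quotW=> x; elim/quotW=> y; elim/quotW=> z.
by rewrite (pi_hadd x y) (pi_hmul x z) (pi_hmul y z) !piE; apply/hpiP; exact: heq_mulDl.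
Qed.

Lemma hmulDr : right_distributive hmul hadd.
Proof.
elim/quotW=> x; elim/quotW=> y; elim/quotW=> z.
by rewrite (pi_hadd y z) (pi_hmul x y) (pi_hmul x z) !piE; apply/hpiP; exact: heq_mulDr.
Qed.

Lemma hcstD a b : hcst (a + b) = hadd (hcst a) (hcst b).
Proof. by rewrite !piE; apply/hpiP; exact: heq_cstD. Qed.

Lemma hcstM a b : hcst (a * b) = hmul (hcst a) (hcst b).
Proof. by rewrite !piE; apply/hpiP; exact: heq_cstM. Qed.

Lemma haddN : left_inverse (hcst 0) hopp hadd.
Proof. by elim/quotW=> x; rewrite /hopp (pi_hmul (HCst (-1)) x) !piE; apply/hpiP; exact: heq_addN. Qed.

Lemma hcst1_neq0 : hcst 1 != hcst 0.
Proof. by apply/eqP=> /hpiP/heq_hchar/eqP; rewrite oner_eq0. Qed.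

HB.instance Definition _ :=
  GRing.isZmodule.Build (hecke n) haddA haddC hadd0 haddN.

HB.instance Definition _ :=
  GRing.Zmodule_isNzRing.Build (hecke n) hmulA hmul1l hmul1r hmulDl hmulDr
    hcst1_neq0.

Lemma hscaleA a b x : hscale a (hscale b x) = hscale (a * b) x.
Proof. by rewrite /hscale hcstM hmulA. Qed.

Lemma hscale1 : left_id 1 hscale.
Proof. exact: hmul1l. Qed.

Lemma hscaleDr : right_distributive hscale +%R.
Proof. by move=> a x y; exact: hmulDr. Qed.

Lemma hscaleDl x : {morph hscale^~ x : a b / a + b}.
Proof. by move=> a b; rewrite /hscale hcstD; exact: hmulDl. Qed.

HB.instance Definition _ :=
  GRing.Zmodule_isLmodule.Build laurent (hecke n) hscaleA hscale1 hscaleDr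
    hscaleDl.

Lemma hscaleAl a x y : a *: (x * y) = a *: x * y.
Proof. exact: hmulA. Qed.

HB.instance Definition _ :=
  GRing.Lmodule_isLalgebra.Build laurent (hecke n) hscaleAl.

Lemma hscaleAr a x y : a *: (x * y) = x * (a *: y).
Proof.
rewrite -[LHS]/(hmul (hcst a) (hmul x y)) -[RHS]/(hmul x (hmul (hcst a) y)).
by rewrite hmulA hcstC -hmulA.
Qed.

HB.instance Definition _ :=
  GRing.Lalgebra_isAlgebra.Build laurent (hecke n) hscaleAr.

End HeckeRing.

Definition Hgen (n : nat) (i : 'I_n.-1) : hecke n := \pi_(hecke n) (HGen i).

(* By the braid relations, independent of the chosen reduced expression. *)
Definition Hbasis (n : nat) (w : 'S_n) : hecke n :=
  \prod_(i <- red_word w) Hgen i.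

(* (H_(w^-1))^-1 = \sum_u r u *: H_u, the inverse being two-sided. *)
Definition R_expansion (n : nat) (w : 'S_n) (r : {ffun 'S_n -> laurent}) :
    Prop :=
  (\sum_u r u *: Hbasis u) * Hbasis w^-1%g = 1 /\
  Hbasis w^-1%g * (\sum_u r u *: Hbasis u) = 1.

Definition Rpoly (n : nat) (u w : 'S_n) : laurent :=
  classical_sets.xget [ffun=> 0] (@R_expansion n w) u.

Definition Rtilde (n : nat) (u w : 'S_n) : {poly nat} :=
  classical_sets.xget 0 (fun p : {poly nat} =>
    Rpoly u w =
    (map_poly (fun k : nat => k%:R) p).[laurent_t - laurent_tV]).

(* Main.v *)
(* Let A_i = H_i^-1 = H_i + q with q = t - t^-1, so that A_i^2 = 1 + q A_i.
   The functional tau that reads off the coefficient of H_e satisfies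
   R_{e,v} = tau(A_{i_1} ... A_{i_k}) for any reduced word of v.  A letter that
   occurs once in a word can be deleted at the price of a factor q: modulo
   terms outside the parabolic subgroup avoiding i, A_i acts as q.
   In a fully commutative word, i - 1 and i + 1 each occur exactly once between
   consecutive occurrences of i, so neighbouring letters that both occur twice
   alternate.  If i is the smallest letter and i, i + 1 both occur twice, then
   commutations, the braid relation i (i+1) i = (i+1) i (i+1), the deletion of i
   and the quadratic relation for i + 1 give
     tau(s) = q^2 tau(s without i) + q^2 tau(s without i, i + 1),
   which is the recursion of the modified Fibonacci polynomials at q. *)
Require Import Defs.
From mathcomp Require Import all_boot all_order all_algebra all_fingroup.
From mathcomp Require Import generic_quotient boolp.
From mathcomp Require classical_sets.
From mathcomp Require Import zify ring.
Import GRing.Theory.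
Local Open Scope ring_scope.
Local Open Scope quotient_scope.

Set Implicit Arguments.
Unset Strict Implicit.
Unset Printing Implicit Defensive.

(** * Reduced words in the symmetric group *)

Section Words.
Variable n : nat.
Implicit Types (i j k : 'I_n.-1) (w v : 'S_n) (s z : seq 'I_n.-1).

Definition lo i : 'I_n := Ordinal (sref_lo_proof i).
Definition hi i : 'I_n := Ordinal (sref_hi_proof i).

(** Products apply the left factor first, so [sref i * w] exchanges the values of [w] at [lo i] and
    [hi i]; this tests whether left multiplication by [sref i] shortens [w]. *)
Definition desc i w : bool := (w (hi i) < w (lo i))%N.

Lemma lo_neq_hi i : lo i != hi i.
Proof. by rewrite -val_eqE /= neq_ltn ltnSn. Qed.

Lemma sref_lo i : sref i (lo i) = hi i.
Proof. exact: tpermL. Qed.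

Lemma sref_hi i : sref i (hi i) = lo i.
Proof. exact: tpermR. Qed.

Lemma sref_fix i (x : 'I_n) :
  x != i :> nat -> x != i.+1 :> nat -> sref i x = x.
Proof. by move=> h1 h2; rewrite tpermD // eq_sym -val_eqE. Qed.

Lemma val_sref i (x : 'I_n) :
  sref i x = (if x == i :> nat then i.+1
              else if x == i.+1 :> nat then nat_of_ord i else x) :> nat.
Proof.
rewrite /sref; case: tpermP => [->|->|/eqP + /eqP +]; rewrite -?val_eqE /=.
- by rewrite eqxx.
- by rewrite eqxx; case: eqP; lia.
- by move=> /negPf-> /negPf->.
Qed.

Lemma srefK i w : (sref i * (sref i * w))%g = w.
Proof. by rewrite mulgA tperm2 mul1g. Qed.

Lemma srefJ i j : ((sref i) ^ (sref j))%g = (sref j * sref i * sref j)%g.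
Proof. by rewrite conjgE tpermV mulgA. Qed.

Lemma sref_comm i j : (i.+1 < j)%N || (j.+1 < i)%N ->
  (sref i * sref j = sref j * sref i)%g.
Proof.
move=> ij; apply: (mulgI (sref j)); rewrite mulgA -srefJ srefK tpermJ.
by rewrite !sref_fix //=; lia.
Qed.

Lemma sref_braid i j : j = i.+1 :> nat ->
  (sref i * (sref j * sref i) = sref j * (sref i * sref j))%g.
Proof.
move=> ji; rewrite !mulgA -!srefJ !tpermJ.
have hl : hi i = lo j by apply: val_inj; rewrite /= ji.
rewrite -/(lo j) -/(hi j) -/(lo i) -/(hi i) -hl sref_hi hl sref_lo.
by rewrite !sref_fix //=; lia.
Qed.

Lemma descM i w : desc i (sref i * w)%g = ~~ desc i w.
Proof.
rewrite /desc !permM sref_lo sref_hi -leqNgt ltn_neqAle.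
by rewrite val_eqE (inj_eq perm_inj) lo_neq_hi.
Qed.

Lemma desc_far i j w : (i.+1 < j)%N || (j.+1 < i)%N ->
  desc i (sref j * w)%g = desc i w.
Proof. by move=> ij; rewrite /desc !permM !sref_fix //=; lia. Qed.

(** * Words for permutations and the exchange property *)

Lemma word_perm_cons i s : word_perm (i :: s) = (sref i * word_perm s)%g.
Proof. by rewrite /word_perm big_cons. Qed.

Lemma word_perm_cat s z : word_perm (s ++ z) = (word_perm s * word_perm z)%g.
Proof. by rewrite /word_perm big_cat. Qed.

Lemma word_perm_rev s : word_perm (rev s) = (word_perm s)^-1%g.
Proof.
elim: s => [|i s IH]; first by rewrite /word_perm !big_nil invg1.
rewrite rev_cons -cats1 word_perm_cat IH !word_perm_cons invMg.
by rewrite {2}/word_perm big_nil mulg1 tpermV.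
Qed.

(* Strong exchange: the reflection is tracked through the word until the
   letter that inverts the pair (a, b). *)
Lemma exchange s (a b : 'I_n) :
  (a < b)%N -> (word_perm s b < word_perm s a)%N ->
  exists2 s', (size s').+1 = size s
            & word_perm s' = (tperm a b * word_perm s)%g.
Proof.
elim: s a b => [|j s IH] a b ab.
  by rewrite /word_perm big_nil !perm1 ltnNge ltnW.
rewrite word_perm_cons !permM => lt_w.
have [ab'|ab'] := ltnP (sref j a) (sref j b).
  have [s' szs' ws'] := IH _ _ ab' lt_w.
  exists (j :: s'); first by rewrite /= szs'.
  rewrite word_perm_cons ws' !mulgA; congr (_ * _)%g.
  by rewrite -tpermJ conjgE tpermV !mulgA tperm2 mul1g.
have [ea eb] : a = lo j /\ b = hi j.
  move: ab'; rewrite !val_sref.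
  by do 4?case: eqP => ?; move=> ?; split; apply: val_inj => /=; lia.
by exists s; rewrite // ea eb srefK.
Qed.

(** Conjugation by the generator at a + d moves the upper end of the transposition (a, a + d) up by
    one; for d = 0 that generator is itself the transposition sought. *)
Lemma tperm_word d (a b : 'I_n) : b = (a + d)%N :> nat ->
  exists s, word_perm s = tperm a b.
Proof.
elim: d b => [|d IH] b eb.
  have -> : b = a by apply: val_inj; rewrite /= eb addn0.
  by exists [::]; rewrite tperm1 /word_perm big_nil.
have lt_k : (a + d < n.-1)%N by have := ltn_ord b; rewrite eb; lia.
pose k := Ordinal lt_k.
have [s ws] := IH (lo k) erefl.
have [ea|nea] := eqVneq a (lo k).
  exists [:: k]; rewrite /word_perm big_seq1 /sref -/(lo k) -/(hi k) -ea.
  by congr tperm; apply: val_inj; rewrite /= eb addnS.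
exists ([:: k] ++ s ++ [:: k]); rewrite !word_perm_cat ws.
rewrite /word_perm big_seq1 mulgA -[X in (X * _ * _)%g]tpermV -mulgA -conjgE.
rewrite tpermJ sref_lo.
have -> : b = hi k by apply: val_inj; rewrite /= eb addnS.
by rewrite sref_fix //=; lia.
Qed.

Lemma ex_word w : exists s, word_perm s = w.
Proof.
have [ts -> _] := prod_tpermP w.
elim: ts => [|[a b] ts [s ws]].
  by exists [::]; rewrite /word_perm !big_nil.
have [s' ws'] : exists s, word_perm s = tperm a b.
  have [ab|/ltnW ab] := leqP a b.
    by apply: (@tperm_word (b - a)); rewrite subnKC.
  by rewrite tpermC; apply: (@tperm_word (a - b)); rewrite subnKC.
by exists (s' ++ s); rewrite word_perm_cat ws ws' big_cons.
Qed.

(** * Reduced words and descents *)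

Lemma ex_reduced w : exists s, reduced_expr w s.
Proof.
have ex_sz : exists l, `[< exists2 s, word_perm s = w & size s = l >].
  by have [s ws] := ex_word w; exists (size s); apply/asboolP; exists s.
have [l /asboolP[s ws <-] min_s] := ex_minnP ex_sz.
by exists s; split=> // s' ws'; apply: min_s; apply/asboolP; exists s'.
Qed.

Lemma red_wordP w : reduced_expr w (red_word w).
Proof. by have [s rs] := ex_reduced w; exact: (classical_sets.xgetI _ rs). Qed.

Lemma reduced_size w s z : reduced_expr w s -> reduced_expr w z ->
  size s = size z.
Proof. by move=> [ws ms] [wz mz]; apply/eqP; rewrite eqn_leq ms ?mz. Qed.

Lemma reduced_rev w s : reduced_expr w s -> reduced_expr w^-1%g (rev s).
Proof.
move=> [ws ms]; split=> [|s' ws']; first by rewrite word_perm_rev ws.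
by rewrite size_rev -(size_rev s') ms // word_perm_rev ws' invgK.
Qed.

Lemma reduced1 : reduced_expr (1 : 'S_n)%g [::].
Proof. by split=> //; rewrite /word_perm big_nil. Qed.

Lemma red_word1 : red_word (1 : 'S_n)%g = [::].
Proof.
by apply: size0nil; rewrite (reduced_size (red_wordP 1%g) reduced1).
Qed.

(** Any word for [sref i * w] inverts the pair ([lo i], [hi i]), so exchange removes one of its
    letters and leaves a word for [w]. *)
Lemma reduced_cons_asc i w s : reduced_expr w s -> ~~ desc i w ->
  reduced_expr (sref i * w)%g (i :: s).
Proof.
move=> [ws ms] asc; split=> [|s' ws']; first by rewrite word_perm_cons ws.
have dsc : desc i (word_perm s') by rewrite ws' descM.
have [s'' <- ws''] := exchange (ltnSn i : (lo i < hi i)%N) dsc.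
by rewrite ltnS ms // ws'' ws' srefK.
Qed.

Lemma reduced_behead i w s : reduced_expr w (i :: s) ->
  reduced_expr (sref i * w)%g s.
Proof.
move=> [ws ms]; split=> [|s' ws']; first by rewrite -ws word_perm_cons srefK.
by have := ms (i :: s'); rewrite word_perm_cons ws' srefK ltnS; apply.
Qed.

(** At an ascent, prepending i would lengthen a reduced word of [w], while removing the first letter
    of [i :: s] shows that [sref i * w] is shorter than [w]. *)
Lemma reduced_desc i w s : reduced_expr w (i :: s) -> desc i w.
Proof.
move=> rs; apply: contraT => asc; have rs' := reduced_behead rs.
have [t rt] := ex_reduced w; have := reduced_cons_asc rt asc.
move=> /(reduced_size rs') /=.
by rewrite -(reduced_size rs rt) /=; lia.
Qed.

Lemma reduced_cons_desc i w s : reduced_expr (sref i * w)%g s -> desc i w ->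
  reduced_expr w (i :: s).
Proof.
move=> rs dw; have := @reduced_cons_asc i _ _ rs.
by rewrite srefK descM dw; apply.
Qed.

(** Here [w] is decreasing on the three points i, i + 1, i + 2, so either side of the braid relation
    can be split off on the left by three successive descents. *)
Lemma desc_next i j w : j = i.+1 :> nat -> desc i w -> desc j w ->
  [/\ desc j (sref i * w)%g, desc i (sref j * (sref i * w))%g,
      desc i (sref j * w)%g & desc j (sref i * (sref j * w))%g].
Proof.
move=> ji; have hl : lo j = hi i by apply: val_inj; rewrite /= ji.
have fi : sref i (hi j) = hi j by rewrite sref_fix //=; lia.
have fj : sref j (lo i) = lo i by rewrite sref_fix //=; lia.
have e1 : sref j (hi i) = hi j by rewrite -hl sref_lo.
have e2 : sref j (hi j) = hi i by rewrite -hl sref_hi.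
rewrite /desc !permM hl !(fi, fj, e1, e2, sref_lo i, sref_hi i) => d1 d2.
split=> //.
all: exact: ltn_trans d2 d1.
Qed.

(* Matsumoto's theorem *)
Lemma reduced_prod (R : nzRingType) (f : 'I_n.-1 -> R) :
  (forall i j, j = i.+1 :> nat -> f i * f j * f i = f j * f i * f j) ->
  (forall i j, (i.+1 < j)%N -> f i * f j = f j * f i) ->
  forall w s z, reduced_expr w s -> reduced_expr w z ->
  \prod_(i <- s) f i = \prod_(i <- z) f i.
Proof.
move=> fbraid fcomm w s z rs rz.
have [N] := ubnP (size s); elim: N w s z rs rz => // N IH w s z rs rz szs.
have szz := reduced_size rs rz.
case: s rs szs szz => [|i s] rs szs; first by case: z rz.
case: z rz => [//|j z] rz [szz]; rewrite !big_cons.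
wlog ij : i j s z rs rz szs szz / (i <= j)%N.
  move=> H; have [ij|/ltnW ij] := leqP i j; first exact: H.
  by apply/esym/H => //; rewrite /= -szz.
have [di dj] := (reduced_desc rs, reduced_desc rz).
have [rs' rz'] := (reduced_behead rs, reduced_behead rz).
have szz' : (size z < N)%N by rewrite -szz.
move: ij; rewrite leq_eqVlt => /orP[/eqP/val_inj eij|].
  by rewrite -eij in rz' *; rewrite (IH _ _ _ rs' rz').
rewrite leq_eqVlt => /orP[/eqP/esym ij|ij].
  (* A reduced word of [w] may start with either braid word, followed by a common tail [t]. Each
     shares its first letter with one of the given words, so induction compares the tails. *)
  have [d1 d2 d3 d4] := desc_next ij di dj.
  have [t rt] := ex_reduced (sref i * (sref j * (sref i * w)))%g.
  have r1 := reduced_cons_desc (reduced_cons_desc rt d2) d1.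
  have rt' : reduced_expr (sref j * (sref i * (sref j * w)))%g t.
    move: rt; rewrite !mulgA -[(_ * _ * sref i)%g]mulgA sref_braid //.
    by rewrite !mulgA.
  have r2 := reduced_cons_desc (reduced_cons_desc rt' d4) d3.
  rewrite (IH _ _ _ rs' r1) // (IH _ _ _ rz' r2) //.
  by rewrite !big_cons !mulrA fbraid.
have far : (j.+1 < i)%N || (i.+1 < j)%N by rewrite ij orbT.
have d1 : desc j (sref i * w)%g by rewrite desc_far.
have d2 : desc i (sref j * w)%g by rewrite desc_far // ij.
have [t rt] := ex_reduced (sref j * (sref i * w))%g.
have rt' : reduced_expr (sref i * (sref j * w))%g t.
  by move: rt; rewrite mulgA sref_comm // -mulgA.
rewrite (IH _ _ _ rs' (reduced_cons_desc rt d1)) //.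
rewrite (IH _ _ _ rz' (reduced_cons_desc rt' d2)) //.
by rewrite !big_cons !mulrA fcomm.
Qed.

End Words.

(** * The regular representation and the trace *)

Definition lq : laurent := laurent_t - laurent_tV.

Section Representation.
Variable n : nat.
Implicit Types (i j : 'I_n.-1) (w v : 'S_n) (s z : seq 'I_n.-1).
Implicit Types (f g : 'S_n -> laurent) (x y : hecke n).

(* Left multiplication by H_i on the coefficients of \sum_w f w *: H_w. *)
Definition Tact i f w : laurent :=
  f (sref i * w)%g - (if desc i w then lq * f w else 0).

Fixpoint hact (x : hterm n) f : 'S_n -> laurent :=
  match x with
  | HCst a => fun w => a * f w
  | HGen i => Tact i f
  | HAdd x y => fun w => hact x f w + hact y f w
  | HMul x y => hact x (hact y f)
  end.

Lemma hact_linear (x : hterm n) a f g :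
  hact x (fun w => a * f w + g w) = (fun w => a * hact x f w + hact x g w).
Proof.
elim: x f g => [b|i|x IHx y IHy|x IHx y IHy] f g /=; apply/funext=> w.
- by ring.
- by rewrite /Tact; case: desc; ring.
- by rewrite IHx IHy; ring.
- by rewrite IHy IHx.
Qed.

Lemma hactD (x : hterm n) f g :
  hact x (fun w => f w + g w) = (fun w => hact x f w + hact x g w).
Proof.
transitivity (hact x (fun w => 1 * f w + g w)).
  by congr hact; apply/funext=> w; rewrite mul1r.
by rewrite hact_linear; apply/funext=> w; rewrite mul1r.
Qed.

Lemma hact0 (x : hterm n) : hact x (fun=> 0) = (fun=> 0).
Proof.
elim: x => [b|i|x IHx y IHy|x IHx y IHy] /=; apply/funext=> w.
- by rewrite mulr0.
- by rewrite /Tact mulr0 if_same subr0.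
- by rewrite IHx IHy addr0.
- by rewrite IHy IHx.
Qed.

Lemma hactZ (x : hterm n) a f :
  hact x (fun w => a * f w) = (fun w => a * hact x f w).
Proof.
transitivity (hact x (fun w => a * f w + 0)).
  by congr hact; apply/funext=> w; rewrite addr0.
by rewrite hact_linear hact0; apply/funext=> w; rewrite addr0.
Qed.

(** Every descent condition that arises compares two of the values of [w] at i, i + 1, i + 2; each
    possible order of these values leaves a ring identity. *)
Lemma Tact_braid i j f : j = i.+1 :> nat ->
  Tact i (Tact j (Tact i f)) = Tact j (Tact i (Tact j f)).
Proof.
move=> ji; have hl : lo j = hi i by apply: val_inj; rewrite /= ji.
have fi : sref i (hi j) = hi j by rewrite sref_fix //=; lia.
have fj : sref j (lo i) = lo i by rewrite sref_fix //=; lia.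
have e1 : sref j (hi i) = hi j by rewrite -hl sref_lo.
have e2 : sref j (hi j) = hi i by rewrite -hl sref_hi.
apply/funext=> w; rewrite /Tact /desc !permM hl.
rewrite !(fi, fj, e1, e2, sref_lo i, sref_hi i) !srefK.
have -> : (sref i * (sref j * (sref i * w)) =
           sref j * (sref i * (sref j * w)))%g.
  by rewrite !mulgA -[(_ * _ * sref i)%g]mulgA sref_braid // !mulgA.
have ne (x y : 'I_n) : x != y :> nat -> w x != w y :> nat.
  by rewrite !val_eqE (inj_eq perm_inj).
have ne1 : w (lo i) != w (hi i) :> nat by apply: ne => /=; lia.
have ne2 : w (lo i) != w (hi j) :> nat by apply: ne => /=; lia.
have ne3 : w (hi i) != w (hi j) :> nat by apply: ne => /=; lia.
by do 6?[case: ltnP => ?]; try (exfalso; lia); ring.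
Qed.

(** The operators satisfy every defining relation, so the action descends to the quotient
    [hecke n]. *)
Lemma heq_hact (x y : hterm n) : heq x y -> hact x = hact y.
Proof.
elim=> //= {x y}.
- by move=> x y z _ -> _ ->.
- by move=> x x' y y' _ -> _ ->.
- by move=> x x' y y' _ -> _ ->.
- by move=> x y z; do 2!apply/funext=> ?; rewrite addrA.
- by move=> x y; do 2!apply/funext=> ?; rewrite addrC.
- by move=> x; do 2!apply/funext=> ?; rewrite mul0r add0r.
- by move=> x; do 2!apply/funext=> ?; rewrite mulN1r addNr mul0r.
- by move=> x; do 2!apply/funext=> ?; rewrite mul1r.
- by move=> x y z; apply/funext=> f; rewrite hactD.
- by move=> a b; do 2!apply/funext=> ?; rewrite mulrDl.
- by move=> a b; do 2!apply/funext=> ?; rewrite mulrA.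
- by move=> a x; apply/funext=> f; rewrite hactZ.
- move=> i; apply/funext=> f; apply/funext=> w; rewrite /Tact srefK descM /lq.
  by case: desc => /=; ring.
- by move=> i j ij; apply/funext=> f; rewrite Tact_braid.
- move=> i j ij; apply/funext=> f; apply/funext=> w; rewrite /Tact.
  rewrite !mulgA (sref_comm (i := i)) ?ij // !desc_far ?ij ?orbT //.
  by do 2!case: desc; ring.
Qed.

Definition act x f : 'S_n -> laurent := hact (repr x) f.

Lemma act_pi (x : hterm n) : act (\pi_(hecke n) x) = hact x.
Proof. by apply: heq_hact; apply/hpiP; rewrite reprK. Qed.

Lemma actM x y f : act (x * y) f = act x (act y f).
Proof. by rewrite -[x * y]/(hmul x y) /hmul act_pi. Qed.

Lemma actD x y f w : act (x + y) f w = act x f w + act y f w.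
Proof. by rewrite -[x + y]/(hadd x y) /hadd act_pi. Qed.

Lemma actZ a x f w : act (a *: x) f w = a * act x f w.
Proof. by rewrite -[a *: x]/(hcst n a * x) actM act_pi. Qed.

Lemma act1 f : act 1 f = f.
Proof.
by rewrite -[1]/(hcst n 1) act_pi; apply/funext=> w /=; rewrite mul1r.
Qed.

Lemma act_gen i f : act (Hgen i) f = Tact i f.
Proof. by rewrite act_pi. Qed.

(** * The coefficient of H_e *)

Definition delta v w : laurent := (v == w)%:R.

(** The functional tau: acting on the coefficient function of H_e gives the coefficients of [x], and
    the one at the identity is read off. *)
Definition Htrace x : laurent := act x (delta 1%g) 1%g.

Lemma HtraceD x y : Htrace (x + y) = Htrace x + Htrace y.
Proof. exact: actD. Qed.

Lemma HtraceZ a x : Htrace (a *: x) = a * Htrace x.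
Proof. exact: actZ. Qed.

Lemma Htrace1 : Htrace 1 = 1.
Proof. by rewrite /Htrace act1 /delta eqxx. Qed.

Lemma Htrace_sum (r : {ffun 'S_n -> laurent}) (B : 'S_n -> hecke n) :
  Htrace (\sum_u r u *: B u) = \sum_u r u * Htrace (B u).
Proof.
apply: (big_ind2 (fun x a => Htrace x = a)) => [|x _ y _ <- <-|u _].
- by rewrite -(scale0r 1) HtraceZ mul0r.
- exact: HtraceD.
- exact: HtraceZ.
Qed.

Lemma Tact_delta i v : ~~ desc i v -> Tact i (delta v) = delta (sref i * v)%g.
Proof.
move=> asc; apply/funext=> w; rewrite /Tact /delta.
have -> : (if desc i w then lq * (v == w)%:R else 0) = 0.
  by case: eqP => [<-|_]; rewrite ?(negPf asc) // mulr0 if_same.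
by rewrite subr0 -(inj_eq (mulgI (sref i))) srefK.
Qed.

Lemma act_reduced w s : reduced_expr w s ->
  act (\prod_(i <- s) Hgen i) (delta 1%g) = delta w.
Proof.
elim: s w => [|i s IH] w rs.
  by case: rs => <- _; rewrite big_nil act1 /word_perm big_nil.
rewrite big_cons actM (IH _ (reduced_behead rs)) act_gen Tact_delta ?srefK //.
by rewrite descM (reduced_desc rs).
Qed.

Lemma Htrace_basis w : Htrace (Hbasis w) = (w == 1%g)%:R.
Proof. by rewrite /Htrace (act_reduced (red_wordP w)). Qed.

(** * Inverses of the generators *)

Definition Hinv i : hecke n := Hgen i + lq%:A.

Lemma Hgen_quad i : Hgen i * Hgen i = 1 - lq *: Hgen i.
Proof.
rewrite -[LHS]/(hmul _ _) pi_hmul; have /hpiP-> := heq_quad i.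
rewrite -pi_hadd -pi_hmul -/(hcst n _) -[hmul _ _]/(_ *: Hgen i).
by rewrite -scaleNr opprB.
Qed.

Lemma Hgen_braid i j : j = i.+1 :> nat ->
  Hgen i * Hgen j * Hgen i = Hgen j * Hgen i * Hgen j.
Proof.
move=> ij; have := heq_braid ij => /hpiP.
by rewrite -!pi_hmul.
Qed.

Lemma Hgen_comm i j : (i.+1 < j)%N -> Hgen i * Hgen j = Hgen j * Hgen i.
Proof.
by move=> ij; have := heq_comm ij => /hpiP; rewrite -!pi_hmul.
Qed.

Lemma HgenK i : Hgen i * Hinv i = 1.
Proof. by rewrite mulrDr Hgen_quad -scalerAr mulr1 subrK. Qed.

Lemma HinvK i : Hinv i * Hgen i = 1.
Proof. by rewrite mulrDl Hgen_quad -scalerAl mul1r subrK. Qed.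

Lemma Hinv_quad i : Hinv i * Hinv i = 1 + lq *: Hinv i.
Proof. by rewrite {1}/Hinv mulrDl HgenK -scalerAl mul1r. Qed.

Lemma Hinv_comm i j : (i.+1 < j)%N -> Hinv i * Hinv j = Hinv j * Hinv i.
Proof.
move=> ij; rewrite /Hinv !mulrDl !mulrDr Hgen_comm //.
rewrite -!scalerAl -!scalerAr !mul1r !mulr1 -!addrA; congr (_ + _).
by rewrite addrCA.
Qed.

(** The two sides are inverse to the two sides of the braid relation for the generators, and
    inverses are unique. *)
Lemma Hinv_braid i j : j = i.+1 :> nat ->
  Hinv i * Hinv j * Hinv i = Hinv j * Hinv i * Hinv j.
Proof.
have KK k l : (Hgen k * Hgen l * Hgen k) * (Hinv k * Hinv l * Hinv k) = 1.
  rewrite -!mulrA (mulrA (Hgen k) (Hinv k)) HgenK mul1r.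
  by rewrite (mulrA (Hgen l)) HgenK mul1r HgenK.
have KK' k l : (Hinv k * Hinv l * Hinv k) * (Hgen k * Hgen l * Hgen k) = 1.
  rewrite -!mulrA (mulrA (Hinv k) (Hgen k)) HinvK mul1r.
  by rewrite (mulrA (Hinv l)) HinvK mul1r HinvK.
move=> ij; rewrite -[LHS]mulr1 -(KK j i) mulrA -Hgen_braid // KK'.
by rewrite mul1r.
Qed.

Lemma prod_HgenK s :
  (\prod_(i <- s) Hgen i) * (\prod_(i <- rev s) Hinv i) = 1 /\
  (\prod_(i <- rev s) Hinv i) * (\prod_(i <- s) Hgen i) = 1.
Proof.
elim: s => [|i s [IH1 IH2]]; first by rewrite !big_nil mulr1.
rewrite rev_cons -cats1 big_cat big_seq1 big_cons /=; split.
  by rewrite mulrA -(mulrA (Hgen i)) IH1 mulr1 HgenK.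
by rewrite mulrA -(mulrA _ (Hinv i)) HinvK mulr1 IH2.
Qed.

(** * Expansions in the elements H_w *)

Definition spanned x : Prop :=
  exists r : {ffun 'S_n -> laurent}, x = \sum_u r u *: Hbasis u.

Lemma spannedD x y : spanned x -> spanned y -> spanned (x + y).
Proof.
move=> [r ->] [r' ->]; exists [ffun u => r u + r' u].
by rewrite -big_split; apply: eq_bigr => u _; rewrite ffunE scalerDl.
Qed.

Lemma spannedZ a x : spanned x -> spanned (a *: x).
Proof.
move=> [r ->]; exists [ffun u => a * r u].
by rewrite scaler_sumr; apply: eq_bigr => u _; rewrite ffunE scalerA.
Qed.

Lemma spanned_basis w : spanned (Hbasis w).
Proof.
exists [ffun u => (u == w)%:R]; rewrite (bigD1 w) //= ffunE eqxx scale1r.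
by rewrite big1 ?addr0 // => u /negPf; rewrite ffunE => ->; rewrite scale0r.
Qed.

Lemma spanned_sum (I : finType) (F : I -> hecke n) :
  (forall k, spanned (F k)) -> spanned (\sum_k F k).
Proof.
move=> sF; apply: big_ind => [|x y|k _]; last exact: sF; last exact: spannedD.
by rewrite -(scale0r (Hbasis 1%g)); apply: spannedZ; apply: spanned_basis.
Qed.

Lemma Hgen_basis i w : ~~ desc i w -> Hgen i * Hbasis w = Hbasis (sref i * w)%g.
Proof.
move=> asc; have := reduced_cons_asc (red_wordP w) asc.
move/(reduced_prod Hgen_braid Hgen_comm)/(_ (red_wordP _)).
by rewrite big_cons.
Qed.

Lemma spanned_Hgen i x : spanned x -> spanned (Hgen i * x).
Proof.
move=> [r ->]; rewrite mulr_sumr; apply: spanned_sum => w.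
rewrite -scalerAr; apply: spannedZ.
have [dw|asc] := boolP (desc i w); last first.
  by rewrite Hgen_basis //; apply: spanned_basis.
(* At a descent H_w = H_i H_(s_i w), which makes the quadratic relation applicable. *)
have /Hgen_basis : ~~ desc i (sref i * w)%g by rewrite descM dw.
rewrite srefK => ew; rewrite -ew mulrA Hgen_quad mulrBl mul1r -scalerAl ew.
rewrite -scaleNr.
by apply: spannedD; last apply: spannedZ; apply: spanned_basis.
Qed.

(** Supplies an expansion of the inverse, so that [Rpoly] does not fall back on the default of
    [xget]. *)
Lemma spanned_prod_Hinv s : spanned (\prod_(i <- s) Hinv i).
Proof.
elim: s => [|i s IH].
  have := spanned_basis 1%g; rewrite /Hbasis red_word1; by rewrite !big_nil.
rewrite big_cons mulrDl -scalerAl mul1r.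
by apply: spannedD; [apply: spanned_Hgen | apply: spannedZ].
Qed.

(** The inverse of H_(v^-1) is the product of the inverted letters along the reverse of a reduced
    word of v^-1, which is a reduced word of v; tau extracts its coefficient at H_e. *)
Lemma Rpoly1E v : Rpoly 1%g v = Htrace (\prod_(i <- red_word v) Hinv i).
Proof.
have rv : reduced_expr v (rev (red_word v^-1%g)).
  by have := reduced_rev (red_wordP v^-1%g); rewrite invgK.
rewrite (reduced_prod Hinv_braid Hinv_comm (red_wordP v) rv).
have [K1 K2] := prod_HgenK (red_word v^-1%g).
have [r er] := spanned_prod_Hinv (rev (red_word v^-1%g)).
(* Since an expansion exists, the chosen [r'] is one as well; its sum is again the inverse, by
   uniqueness of inverses. *)
have /(classical_sets.xgetI [ffun=> 0]) : R_expansion v r.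
  by rewrite /R_expansion -er.
rewrite /Rpoly; set r' := classical_sets.xget _ _ => -[h1 h2].
have <- : \sum_u r' u *: Hbasis u = \prod_(i <- rev (red_word v^-1%g)) Hinv i.
  by rewrite -[LHS]mulr1 -[X in _ * X = _]K1 mulrA -/(Hbasis _) h1 mul1r.
rewrite Htrace_sum (bigD1 1%g) //= Htrace_basis eqxx mulr1 big1 ?addr0 //.
by move=> u /negPf nu; rewrite Htrace_basis nu mulr0.
Qed.

(* The parabolic subgroup generated by all [sref j] with [j != i]. *)
Definition stab i w : bool := [forall x : 'I_n, (w x <= i)%N == (x <= i)%N].

Lemma stabM i j w : j != i -> stab i (sref j * w)%g = stab i w.
Proof.
move=> ji; have ij : nat_of_ord i <> j.
  by move=> /val_inj eij; rewrite eij eqxx in ji.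
have le_sref (x : 'I_n) : (sref j x <= i)%N = (x <= i)%N.
  by rewrite val_sref; do 2?case: eqP => ?; lia.
apply/forallP/forallP => st x; last by rewrite permM (eqP (st _)) le_sref.
by have /eqP := st (sref j x); rewrite permM tpermK le_sref => ->.
Qed.

Lemma stab1 i : stab i 1%g.
Proof. by apply/forallP=> x; rewrite perm1. Qed.

Lemma stab_asc i w : stab i w -> ~~ desc i w.
Proof.
move=> /forallP st; rewrite /desc -leqNgt.
have := st (lo i); have := st (hi i); rewrite /= ltnn leqnn => /eqP h1 /eqP h2.
by lia.
Qed.

Lemma stab_sref i w : stab i w -> ~~ stab i (sref i * w)%g.
Proof.
move=> /forallP st; apply/negP=> /forallP/(_ (lo i)).
by rewrite permM sref_lo (eqP (st _)) /= ltnn leqnn.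
Qed.

Lemma act_Hinv i f w : act (Hinv i) f w = Tact i f w + lq * f w.
Proof. by rewrite /Hinv actD act_gen actZ act1. Qed.

(** Letters other than i preserve the functions supported on the parabolic subgroup ([b = false])
    and those vanishing on it ([b = true]). *)
Lemma act_prod_stab i (b : bool) s f : i \notin s ->
  (forall w, stab i w = b -> f w = 0) ->
  forall w, stab i w = b -> act (\prod_(j <- s) Hinv j) f w = 0.
Proof.
move=> + f0; elim: s => [|j s IH]; first by rewrite big_nil act1.
rewrite inE negb_or => /andP[ij /IH{}IH] w sw.
rewrite big_cons actM act_Hinv /Tact !IH ?stabM 1?eq_sym //.
by rewrite mulr0 if_same subr0 addr0.
Qed.

(** * Traces of words *)

Definition Ftrace s : laurent := Htrace (\prod_(i <- s) Hinv i).

Lemma act_sum x f g :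
  act x (fun w => f w + g w) = (fun w => act x f w + act x g w).
Proof. exact: hactD. Qed.

Lemma Ftrace_single i s z : i \notin s -> i \notin z ->
  Ftrace (s ++ i :: z) = lq * Ftrace (s ++ z).
Proof.
move=> is_ iz; rewrite /Ftrace /Htrace !big_cat big_cons /= !actM.
set g := act (\prod_(j <- z) _) _.
have g0 w : stab i w = false -> g w = 0.
  apply: act_prod_stab => // {}w; rewrite /delta; case: eqP => // <-.
  by rewrite stab1.
have -> : act (Hinv i) g = (fun w => Tact i g w + lq * g w).
  by apply/funext=> w; exact: act_Hinv.
(* As [g] lives on the parabolic subgroup, [Tact i g] vanishes there: [sref i] leads out of the
   subgroup, and i is an ascent of each of its elements. The letters of [s] keep it zero at the
   identity, so only the multiple of [g] by q remains. *)
rewrite act_sum (@act_prod_stab i true) ?stab1 ?add0r //; first last.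
  move=> w sw; rewrite /Tact (negPf (stab_asc sw)) subr0 g0 //.
  exact/negbTE/stab_sref.
by rewrite [act _ _]hactZ.
Qed.

Lemma Ftrace_nil : Ftrace [::] = 1.
Proof. by rewrite /Ftrace big_nil Htrace1. Qed.

Lemma Ftrace_quad i s z :
  Ftrace (s ++ i :: i :: z) = Ftrace (s ++ z) + lq * Ftrace (s ++ i :: z).
Proof.
rewrite /Ftrace -HtraceZ -HtraceD !big_cat !big_cons /=; congr Htrace.
by rewrite (mulrA (Hinv i)) Hinv_quad mulrDl mul1r mulrDr -scalerAl -scalerAr.
Qed.

Lemma Ftrace_braid i j s z : j = i.+1 :> nat ->
  Ftrace (s ++ i :: j :: i :: z) = Ftrace (s ++ j :: i :: j :: z).
Proof.
move=> ij; rewrite /Ftrace !big_cat !big_cons /=; congr (Htrace (_ * _)).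
by rewrite !mulrA Hinv_braid.
Qed.

Lemma Ftrace_comm i j s z : (i.+1 < j)%N || (j.+1 < i)%N ->
  Ftrace (s ++ i :: j :: z) = Ftrace (s ++ j :: i :: z).
Proof.
move=> ij; rewrite /Ftrace !big_cat !big_cons /=; congr (Htrace (_ * _)).
by rewrite !mulrA; case/orP: ij => /Hinv_comm ->.
Qed.

End Representation.

(** * Alternation in fully commutative words *)

Lemma count_split (T : eqType) (a : pred T) (s : seq T) :
  (0 < count a s)%N ->
  exists x i y, [/\ s = x ++ i :: y, a i, count a x = 0%N
                  & count a s = (count a y).+1].
Proof.
elim: s => [//|i s IH] /=; case ai: (a i); first by exists [::], i, s.
rewrite add0n => /IH[x [j [y [-> aj cx cs]]]].
by exists (i :: x), j, y; split; rewrite //= ai.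
Qed.

Lemma count_mem_split (T : eqType) (i : T) (s : seq T) :
  (0 < count_mem i s)%N ->
  exists x y, [/\ s = x ++ i :: y, i \notin x
                & count_mem i s = (count_mem i y).+1].
Proof.
case/count_split=> x [j [y [-> /eqP-> cx cs]]].
by exists x, y; split=> //; apply/count_memPn.
Qed.

Lemma count_mem_split2 (T : eqType) (i : T) (s : seq T) :
  (1 < count_mem i s)%N ->
  exists x y z, [/\ s = x ++ i :: y ++ i :: z, i \notin x, i \notin y
                & count_mem i s = (count_mem i z).+2].
Proof.
move=> c2; have [x [y [es ix cs]]] := count_mem_split (ltnW c2).
have [|y1 [y2 [ey iy cy]]] := @count_mem_split _ i y.
  by rewrite -ltnS -cs.
by exists x, y1, y2; split=> //; rewrite ?cs ?cy // es ey.
Qed.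

Section Alternation.
Variable n : nat.
Implicit Types (i j : 'I_n.-1) (v : 'S_n) (s x y z : seq 'I_n.-1).

Definition far i j := (i.+1 < j)%N || (j.+1 < i)%N.

(** The flag selects the side, so that the arguments going up and going down the alphabet are a
    single induction. *)
Definition nbr (up : bool) i j : bool :=
  if up then j == i.+1 :> nat else i == j.+1 :> nat.

Definition adj i j := nbr true i j || nbr false i j.

Definition alternate i j s : bool :=
  [seq k <- s | pred2 i j k] \in [:: [:: i; j; i; j]; [:: j; i; j; i]].

Lemma farE i j : far i j = (j != i) && ~~ adj i j.
Proof. by rewrite /far /adj /= -val_eqE /=; lia. Qed.

Lemma word_perm_move i x : all (far i) x ->
  word_perm (i :: x) = word_perm (x ++ [:: i]).
Proof.
elim: x => [|j x IH] //= /andP[ij /IH]; rewrite !word_perm_cons => <-.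
by rewrite !mulgA sref_comm.
Qed.

Lemma filter_pred2 i j x : i \notin x ->
  [seq k <- x | pred2 i j k] = nseq (count_mem j x) j.
Proof.
elim: x => //= k x IH; rewrite inE negb_or eq_sym => /andP[/negPf-> /IH->] /=.
by case: eqP => [->|].
Qed.

Lemma filter_pred2_split i j z x y :
  i \notin z -> i \notin x -> i \notin y ->
  [seq k <- z ++ i :: x ++ i :: y | pred2 i j k] =
  nseq (count_mem j z) j ++ i :: nseq (count_mem j x) j
    ++ i :: nseq (count_mem j y) j.
Proof.
move=> iz ix iy; rewrite filter_cat /= filter_cat /= eqxx /=.
by rewrite !filter_pred2.
Qed.

Lemma alternate_between i j z x y : i != j ->
  i \notin z -> i \notin x -> i \notin y ->
  alternate i j (z ++ i :: x ++ i :: y) ->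
  count_mem j x = 1%N /\ (count_mem j z + count_mem j y = 1)%N.
Proof.
move=> ij iz ix iy; rewrite /alternate filter_pred2_split // !inE.
have ji : j != i by rewrite eq_sym.
case: (count_mem j z) => [|[|a]]; case: (count_mem j x) => [|[|c]];
  case: (count_mem j y) => [|[|b]] //=;
  by rewrite !eqseq_cons ?(negPf ij) ?(negPf ji) ?andbF ?orbF.
Qed.

Section FullyCommutative.
Variables (v : 'S_n) (s : seq 'I_n.-1).
Hypotheses (rs : reduced_expr v s) (v321 : avoids321 v).

(** With no neighbour in between, the two copies of i commute together and cancel, against
    reducedness; with exactly one neighbour j they close in on it to a factor i j i, against
    321-avoidance. *)
Lemma two_adjacent_between z i x y : s = z ++ i :: x ++ i :: y ->
  i \notin x -> (1 < count (adj i) x)%N.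
Proof.
move=> es ix; have [ws ms] := rs.
have allfar t : i \notin t -> count (adj i) t = 0%N -> all (far i) t.
  move=> it /eqP; rewrite -leqn0 leqNgt -has_count -all_predC => /allP at_.
  apply/allP=> k kt; rewrite farE; apply/andP; split; last exact: at_.
  by apply: contraNneq it => <-.
rewrite ltnNge; apply/negP; rewrite leq_eqVlt => /orP[/eqP c1|c0].
  have [|x1 [j [x2 [ex aj cx1 c2]]]] := @count_split _ (adj i) x.
    by rewrite c1.
  have cx2 : count (adj i) x2 = 0%N by apply: succn_inj; rewrite -c2.
  have [ix1 ix2] : i \notin x1 /\ i \notin x2.
    by move: ix; rewrite ex mem_cat inE !negb_or => /and3P[].
  have rs' : reduced_expr v (z ++ x1 ++ i :: j :: i :: x2 ++ y).
    split; last first.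
      by move=> t /ms; rewrite es ex; do ?rewrite size_cat /=; lia.
    rewrite -ws es ex.
    have e1 := word_perm_move (allfar _ ix1 cx1).
    have e2 := word_perm_move (allfar _ ix2 cx2).
    have -> : z ++ x1 ++ i :: j :: i :: x2 ++ y =
              z ++ (x1 ++ [:: i]) ++ [:: j] ++ (i :: x2) ++ y.
      by rewrite -!catA.
    have -> : z ++ i :: (x1 ++ j :: x2) ++ i :: y =
              z ++ (i :: x1) ++ [:: j] ++ (x2 ++ [:: i]) ++ y.
      by rewrite /= -!catA.
    by rewrite !word_perm_cat in e1 e2 *; rewrite e1 e2.
  have ij : j = i.+1 :> nat \/ i = j.+1 :> nat.
    by case/orP: aj => /eqP; [left|right].
  have /negP[] := v321 rs' ij.
  by apply/infixP; exists (z ++ x1), (x2 ++ y); rewrite -!catA.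
have cx : count (adj i) x = 0%N by lia.
have := ms (z ++ x ++ y); rewrite -ws es.
have e := word_perm_move (allfar _ ix cx).
have exy : word_perm ((i :: x) ++ i :: y) = word_perm (x ++ y).
  rewrite word_perm_cat e -word_perm_cat -catA /= !(word_perm_cat x).
  by rewrite !word_perm_cons srefK.
rewrite !(word_perm_cat z) -cat_cons exy.
by move=> /(_ erefl); do ?rewrite size_cat /=; lia.
Qed.

(* If a neighbour on one side is missing between two consecutive occurrences
   of i, two copies of the other neighbour j occur there with no i in between,
   and the same happens for j: this walks off the end of the alphabet. *)
Lemma neighbour_between (up : bool) z i x y : s = z ++ i :: x ++ i :: y ->
  i \notin x -> has (nbr up i) x.
Proof.
(* The walk goes down when the upper neighbour is missing and up when the lower one is; the measure
   decreases towards the end it heads for. *)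
have [N] := ubnP (if up then nat_of_ord i else n - i)%N.
elim: N z i x y => // N IH z i x y ltN es ix.
apply: contraT => noup; have := two_adjacent_between es ix.
have -> : count (adj i) x = count (nbr (~~ up) i) x.
  apply: eq_in_count => k kx; move/hasPn/(_ k kx): noup.
  by rewrite /adj; case: (up) => /negPf-> //=; rewrite orbF.
move=> c2; have [x1 [j [x2 [ex ij cx1 c1]]]] := count_split (ltnW c2).
have enb : nbr (~~ up) i =1 pred1 j.
  move=> k; rewrite /= -val_eqE; move: ij; rewrite /nbr.
  by case: (up) => /=; lia.
have [|x3 [x4 [ex2 jx3 _]]] := @count_mem_split _ j x2.
  by rewrite -(eq_count enb) -ltnS -c1.
have /hasP[k kx3 jk] : has (nbr up j) x3.
  apply: (IH (z ++ i :: x1) j x3 (x4 ++ i :: y)) => //.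
    by move: ltN ij; rewrite /nbr; have := ltn_ord i; have := ltn_ord j;
       case: (up) => /=; lia.
  by rewrite es ex ex2 -!catA /= -!catA.
(* The neighbour of j on the missing side is i itself, which [x] avoids. *)
have ki : k = i.
  by apply: val_inj; move: ij jk; rewrite /nbr; case: (up) => /=; lia.
by move: ix; rewrite ex ex2 !(mem_cat, inE) -ki kx3 !orbT.
Qed.

(** Some j lies between the two copies of i. Two of them there would enclose a further i, so exactly
    one does, and the other j lies outside. *)
Lemma reduced_alternate i j : j = i.+1 :> nat ->
  count_mem i s = 2%N -> count_mem j s = 2%N -> alternate i j s.
Proof.
move=> ij ci cj; have [|z [x [y [es iz ix cy]]]] := @count_mem_split2 _ i s.
  by rewrite ci.
have iy : i \notin y by apply/count_memPn; lia.
have enb : nbr true i =1 pred1 j by move=> k; rewrite /= -val_eqE /= ij.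
have cx1 : (0 < count_mem j x)%N.
  by rewrite -(eq_count enb) -has_count (neighbour_between true es ix).
have cx2 : (count_mem j x <= 1)%N.
  rewrite leqNgt; apply/negP=> /count_mem_split2[x1 [x2 [x3 [ex _ jx2 _]]]].
  have /hasP[k kx2] : has (nbr false j) x2.
    apply: (neighbour_between false (z := z ++ i :: x1)
              (y := x3 ++ i :: y)) => //.
    by rewrite es ex -!catA /= -!catA.
  rewrite /nbr ij => /eqP[] /val_inj ek.
  by move: ix; rewrite ex !(mem_cat, inE) ek kx2 !orbT.
have {cx1 cx2} cx : count_mem j x = 1%N by lia.
have nij : (i == j) = false by rewrite -val_eqE /=; lia.
have cyz : (count_mem j z + count_mem j y = 1)%N.
  by move: cj; rewrite es !count_cat /= !count_cat /= nij cx; lia.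
rewrite /alternate es filter_pred2_split // cx !inE.
by case: (count_mem j z) cyz => [|[|?]]; case: (count_mem j y) => [|[|?]] //= _;
   rewrite eqxx ?orbT.
Qed.

End FullyCommutative.
End Alternation.

(** * Reduction of words *)

Definition evq (p : {poly nat}) : laurent :=
  (map_poly (fun k : nat => k%:R) p).[lq].

Lemma evqD p r : evq (p + r) = evq p + evq r.
Proof. by rewrite /evq rmorphD hornerD. Qed.

Lemma evqM p r : evq (p * r) = evq p * evq r.
Proof. by rewrite /evq rmorphM hornerM. Qed.

Lemma evq1 : evq 1 = 1.
Proof. by rewrite /evq rmorph1 hornerC. Qed.

Lemma evqX : evq 'X = lq.
Proof. by rewrite /evq map_polyX hornerX. Qed.

Lemma evqXn k : evq 'X^k = lq ^+ k.
Proof. by elim: k => [|k IH]; rewrite ?expr0 ?evq1 // !exprS evqM IH evqX. Qed.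

(* The value 1 at 0, where [modFib] gives 'X, extends the recursion [GfibSS]
   down to k = 0. *)
Definition Gfib (k : nat) : laurent := if k is 0 then 1 else evq (modFib k).

Lemma Gfib1 : Gfib 1%N = 1 + lq ^+ 2.
Proof.
by rewrite /Gfib /modFib /= expr0 mul1r evqD evqM evqX evq1 addrC expr2.
Qed.

Lemma FibSS k : Fib k.+2 = 'X * Fib k.+1 + Fib k.
Proof. by []. Qed.

Lemma GfibSS k : Gfib k.+2 = lq ^+ 2 * Gfib k.+1 + lq ^+ 2 * Gfib k.
Proof.
case: k => [|k].
  rewrite [Gfib 0%N]/= Gfib1 /Gfib /modFib [Fib 3]/= [2.-1]/= expr1.
  by rewrite !(evqD, evqM, evqX, evq1); ring.
rewrite /Gfib /modFib (FibSS k.+2) !succnK.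
by rewrite !(evqD, evqM, evqXn, evqX) !exprS; ring.
Qed.

Arguments Gfib : simpl never.

(* The value predicted by the theorem, from the list c of the numbers of
   occurrences of consecutive letters; [prev2] tells whether the letter just
   before them occurs twice, i.e. whether a 2 in front continues a chain. *)
Fixpoint chain_eval (prev2 : bool) (c : seq nat) : laurent :=
  if c is x :: c' then
    (if (x == 2%N) && ~~ prev2 then Gfib (find (predC1 2%N) c) else 1)
    * (if x == 1%N then lq else 1) * chain_eval (x == 2%N) c'
  else 1.

(** The flag only decides whether a run of 2s at the front is charged; for an empty run the factor
    is [Gfib 0], which is 1. *)
Lemma chain_eval_false c :
  chain_eval false c = Gfib (find (predC1 2%N) c) * chain_eval true c.
Proof.
case: c => [|x c] /=; rewrite ?mulr1 //.
by case: eqP => [->|_] /=; rewrite !(mul1r, mulr1).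
Qed.

Lemma chain_eval2 c : chain_eval false (2%N :: c)
  = Gfib (find (predC1 2%N) c).+1 * chain_eval true c.
Proof. by rewrite /= mulr1. Qed.

Lemma chain_eval22 c : chain_eval false (2%N :: 2%N :: c)
  = lq ^+ 2 * chain_eval false (2%N :: c) + lq ^+ 2 * chain_eval false c.
Proof. by rewrite !chain_eval2 chain_eval_false /= GfibSS; ring. Qed.

Lemma chain_eval2n c : head 0%N c != 2%N ->
  chain_eval false (2%N :: c) = (1 + lq ^+ 2) * chain_eval false c.
Proof.
rewrite chain_eval2 chain_eval_false.
by case: c => [|x c] /=; [|move/negPf->]; rewrite Gfib1 ?mul1r.
Qed.

(** * Recursion on the smallest letter *)

Section Reduction.
Variable n : nat.
Implicit Types (i j : 'I_n.-1) (s x y z : seq 'I_n.-1).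

Definition del i s := [seq j <- s | j != i].

Definition counts s k d :=
  [seq count (fun i : 'I_n.-1 => i == l :> nat) s | l <- iota k d].

Lemma del_cat i s z : del i (s ++ z) = del i s ++ del i z.
Proof. exact: filter_cat. Qed.

Lemma del_cons i s : del i (i :: s) = del i s.
Proof. by rewrite /del /= eqxx. Qed.

Lemma del_notin i s : i \notin s -> del i s = s.
Proof.
move=> is_; apply/all_filterP/allP=> j js.
by apply: contraNneq is_ => <-.
Qed.

Lemma mem_del i j s : (j \in del i s) = (j != i) && (j \in s).
Proof. by rewrite mem_filter. Qed.

Lemma delC i j s : del i (del j s) = del j (del i s).
Proof.
by rewrite /del -!filter_predI; apply: eq_filter => k /=; rewrite andbC.
Qed.

Lemma count_mem_del i j s : j != i -> count_mem j (del i s) = count_mem j s.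
Proof.
move=> ji; rewrite count_filter; apply: eq_count => k /=.
by case: eqP => [->|//]; rewrite ji.
Qed.

Lemma alternate_del i j k s : i != k -> j != k ->
  alternate i j (del k s) = alternate i j s.
Proof.
move=> ik jk; rewrite /alternate -filter_predI; congr in_mem.
apply: eq_filter => l /=.
by case: eqP => [->|_]; rewrite ?ik //=; case: eqP => [->|]; rewrite ?jk.
Qed.

Lemma counts_del i s k d : (i < k)%N -> counts (del i s) k d = counts s k d.
Proof.
move=> ik; apply/eq_in_map => j; rewrite mem_iota => /andP[kj _].
rewrite count_filter; apply: eq_count => l /=; rewrite -val_eqE /=.
by case: eqP => // ->; lia.
Qed.

Lemma counts_cons i s d : counts s i d.+1 = count_mem i s :: counts s i.+1 d.
Proof. by []. Qed.

(** What survives the deletion of the smallest letter. Avoidance of 321 itself is lost: deleting 0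
    from 1 0 2 1 leaves 1 2 1. *)
Definition admissible k s :=
  [/\ forall i, i \in s -> (k <= i)%N, forall i, (count_mem i s <= 2)%N &
      forall i j, j = i.+1 :> nat ->
      count_mem i s = 2%N -> count_mem j s = 2%N -> alternate i j s].

Lemma admissible_del i s : admissible i s -> admissible i.+1 (del i s).
Proof.
move=> [ge_s le2 alt_s]; split.
- move=> j; rewrite mem_del => /andP[ji /ge_s]; rewrite leq_eqVlt.
  by rewrite val_eqE eq_sym (negPf ji).
- move=> j; apply: leq_trans (le2 j); rewrite count_filter.
  by apply: sub_count => k /andP[].
- move=> j k jk; have [->|ji] := eqVneq j i.
    by rewrite (count_memPn _) // mem_del eqxx.
  have [->|ki] := eqVneq k i.
    by rewrite (count_memPn (_ : i \notin _)) // mem_del eqxx.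
  by rewrite !count_mem_del // alternate_del //; apply: alt_s.
Qed.

Lemma Ftrace_del1 i s : count_mem i s = 1%N -> Ftrace s = lq * Ftrace (del i s).
Proof.
move=> c1; have [|x [y [es ix cy]]] := @count_mem_split _ i s.
  by rewrite c1.
have iy : i \notin y by apply/count_memPn; lia.
by rewrite es Ftrace_single // del_cat del_cons !del_notin.
Qed.

Lemma Ftrace_move i x s z : all (far i) x ->
  Ftrace (s ++ i :: x ++ z) = Ftrace (s ++ x ++ i :: z).
Proof.
elim: x s => [|j x IH] s //= /andP[ij fx].
by rewrite Ftrace_comm // -cat_rcons IH // cat_rcons.
Qed.

(** Both copies of i commute together; of 1 + q A_i, the second term contains a single i and gives
    another factor q. *)
Lemma Ftrace_del2 i s : count_mem i s = 2%N ->
  (forall j, j \in s -> j != i -> far i j) ->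
  Ftrace s = (1 + lq ^+ 2) * Ftrace (del i s).
Proof.
move=> c2 far_s; have [|z [x [y [es iz ix cy]]]] := @count_mem_split2 _ i s.
  by rewrite c2.
have iy : i \notin y by apply/count_memPn; lia.
have fx : all (far i) x.
  apply/allP=> j jx; apply: far_s; first by rewrite es !(mem_cat, inE) jx !orbT.
  by apply: contraNneq ix => <-.
rewrite es Ftrace_move // catA Ftrace_quad.
rewrite Ftrace_single ?mem_cat ?negb_or ?iz //.
by rewrite !del_cat del_cons del_cat del_cons !del_notin // catA; ring.
Qed.

Lemma Ftrace_del22 i j s : j = i.+1 :> nat ->
  (forall k, k \in s -> (i <= k)%N) ->
  count_mem i s = 2%N -> count_mem j s = 2%N -> alternate i j s ->
  Ftrace s = lq ^+ 2 * Ftrace (del i s) + lq ^+ 2 * Ftrace (del j (del i s)).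
Proof.
move=> ij ge_s ci cj alt_s.
have [|z [x [y [es iz ix cy]]]] := @count_mem_split2 _ i s; first by rewrite ci.
have iy : i \notin y by apply/count_memPn; lia.
have nij : i != j by rewrite -val_eqE /=; lia.
rewrite es in alt_s; have [cx czy] := alternate_between nij iz ix iy alt_s.
have [|x1 [x2 [ex jx1 cx2]]] := @count_mem_split _ j x; first by rewrite cx.
have jx2 : j \notin x2 by apply/count_memPn; lia.
(* As i is the smallest letter, i + 1 is the only other letter that fails to commute with it. *)
have fartail t : i \notin t -> j \notin t -> {subset t <= s} -> all (far i) t.
  move=> it jt ts; apply/allP=> k kt; have := ge_s _ (ts _ kt); rewrite /far.
  have : k != i by apply: contraNneq it => <-.
  have : k != j by apply: contraNneq jt => <-.
  by move: ij; rewrite -!val_eqE /=; clear; lia.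
have [ix1 ix2] : i \notin x1 /\ i \notin x2.
  by move: ix; rewrite ex mem_cat inE !negb_or => /and3P[].
have f1 : all (far i) x1.
  by apply: fartail => // k kx; rewrite es ex !(mem_cat, inE) kx !orbT.
have f2 : all (far i) x2.
  by apply: fartail => // k kx; rewrite es ex !(mem_cat, inE) kx !orbT.
have -> : Ftrace s = Ftrace ((z ++ x1) ++ i :: j :: i :: x2 ++ y).
  rewrite es ex -!catA Ftrace_move //=.
  have -> : z ++ x1 ++ i :: j :: x2 ++ i :: y =
            (z ++ x1 ++ [:: i; j]) ++ x2 ++ i :: y.
    by rewrite -!catA.
  by rewrite -(@Ftrace_move i x2) // -!catA.
rewrite Ftrace_braid //.
have -> : (z ++ x1) ++ j :: i :: j :: x2 ++ y =
          (z ++ x1 ++ [:: j]) ++ i :: j :: x2 ++ y.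
  by rewrite -!catA.
rewrite Ftrace_single; first last.
- by rewrite inE mem_cat !negb_or nij ix2.
- by rewrite !mem_cat inE !negb_or iz ix1 nij.
have -> : (z ++ x1 ++ [:: j]) ++ j :: x2 ++ y = (z ++ x1) ++ j :: j :: x2 ++ y.
  by rewrite -!catA.
rewrite Ftrace_quad.
have eds : del i s = (z ++ x1) ++ j :: x2 ++ y.
  rewrite es !del_cat del_cons del_cat del_cons !del_notin // ex.
  by rewrite -!catA.
(* In the unit term of the quadratic relation only the j outside the two copies of i is left;
   removing it gives the second factor q. *)
rewrite -eds (@Ftrace_del1 j ((z ++ x1) ++ x2 ++ y)).
  have -> : del j ((z ++ x1) ++ x2 ++ y) = del j (del i s).
    by rewrite eds !(del_cat, del_cons).
  by ring.
by rewrite !count_cat (count_memPn jx1) (count_memPn jx2) addn0.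
Qed.

(** The cases are the multiplicity of the smallest letter and, if it is 2, that of the next one.
    Induction is strong because two adjacent 2s call for the deletion of two letters. *)
Lemma Ftrace_counts d k s : (k + d = n.-1)%N -> admissible k s ->
  Ftrace s = chain_eval false (counts s k d).
Proof.
elim/ltn_ind: d k s => d IH k s kd adm; have [ge_s le2 alt_s] := adm.
case: d => [|d] in IH kd *.
  case: s ge_s {le2 alt_s adm} => [|i s] ge_s; first by rewrite Ftrace_nil.
  by have := ge_s i (mem_head _ _); have := ltn_ord i; lia.
have lt_k : (k < n.-1)%N by lia.
pose i := Ordinal lt_k; have ek : k = i by [].
rewrite ek in ge_s adm *; rewrite counts_cons.
have IHd : Ftrace (del i s) = chain_eval false (counts s i.+1 d).
  by rewrite (IH d _ i.+1 _ _ (admissible_del adm)) ?counts_del //=; lia.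
have := le2 i; case ci: (count_mem i s) => [|[|[|//]]] _ /=.
- by rewrite mul1r mul1r -IHd del_notin //; apply/count_memPn.
- by rewrite mul1r -IHd; apply: Ftrace_del1.
case: d => [|d] in IH kd IHd *.
  rewrite -[RHS]/(chain_eval false [:: 2%N]) chain_eval2n //.
  rewrite -[chain_eval _ _]IHd.
  apply: Ftrace_del2 => // j /ge_s; have := ltn_ord j; rewrite -val_eqE /far /=.
  by lia.
have lt_j : (i.+1 < n.-1)%N by rewrite /=; lia.
pose j := Ordinal lt_j; have ej : i.+1 = j by [].
rewrite ej counts_cons in IHd *.
have nij : i != j by rewrite -val_eqE /=; lia.
have cji : count_mem j (del i s) = count_mem j s.
  by rewrite count_mem_del // eq_sym.
have farj t : {subset t <= s} -> j \notin t ->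
    forall k, k \in t -> k != i -> far i k.
  move=> ts jt l lt_; have := ge_s _ (ts _ lt_).
  have : l != j by apply: contraNneq jt => <-.
  by rewrite -!val_eqE /far /=; lia.
rewrite -[RHS]/(chain_eval false (2%N :: count_mem j s :: _)).
have := le2 j; case cj: (count_mem j s) => [|[|[|//]]] _; rewrite cj in IHd.
- rewrite chain_eval2n // -IHd; apply: Ftrace_del2 => //.
  by apply: farj => //; apply/count_memPn.
(* With the single j removed, i commutes with all other letters; the factor q of j appears on both
   sides. *)
- rewrite chain_eval2n // -IHd (Ftrace_del1 cj).
  rewrite (@Ftrace_del1 j (del i s)) ?cji //.
  rewrite (@Ftrace_del2 i (del j s)) ?count_mem_del //.
    by rewrite delC; ring.
  by apply: farj => [l|]; rewrite mem_del ?eqxx // => /andP[].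
have adm' : admissible j (del i s) := admissible_del adm.
rewrite chain_eval22 -IHd (Ftrace_del22 (j := j) (i := i)) //; last first.
  exact: alt_s.
rewrite (IH d _ j.+1 _ _ (admissible_del adm')) //; last by rewrite /=; lia.
by rewrite !counts_del.
Qed.

End Reduction.

(** * Two-chains *)

Local Notation tF := (FracField.tofrac ('X : {poly int})).

(* Multiply by t^d and set t = 0: only the leading coefficient survives. *)
Lemma lq_transcendental (P : {poly int}) :
  (map_poly intr P).[lq] = 0 -> P = 0.
Proof.
move=> P0; apply/eqP; apply: contraT => nzP.
have szP : (0 < size P)%N by rewrite size_poly_gt0.
pose N := (size P).-1; have eN : size P = N.+1 by rewrite prednK.
(* This is t^N P(q) with denominators cleared, by t q = t^2 - 1. *)
pose Q : {poly int} :=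
  \sum_(k < N.+1) (P`_k)%:P * ('X ^+ 2 - 1) ^+ k * 'X ^+ (N - k).
have Q0 : Q = 0.
  apply/eqP; rewrite -tofrac_eq0 /Q rmorph_sum /=; apply/eqP.
  transitivity (val (map_poly intr P).[lq] * tF ^+ N); last first.
    by rewrite P0 rmorph0 mul0r.
  rewrite (@horner_coef_wide _ N.+1) -?eN ?size_poly // eN rmorph_sum mulr_suml.
  apply: eq_bigr => k _.
  rewrite coef_map !rmorphM !rmorphXn rmorph_int rmorphB rmorphXn rmorph1 /=.
  have -> : tF ^+ N = tF ^+ k * tF ^+ (N - k) by rewrite -exprD subnKC // -ltnS.
  rewrite !mulrA; congr (_ * _).
  rewrite -mulrA -exprMn; congr (_ * _ ^+ _).
    by rewrite -[P`_k in LHS]intz !rmorph_int.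
  by rewrite mulrBl mulVf ?tF_neq0 // expr2.
have := congr1 (horner^~ 0) Q0; rewrite horner0 /Q horner_sum big_ord_recr /=.
rewrite big1 ?add0r => [|k _]; last first.
  by rewrite !hornerM hornerXn expr0n subn_eq0 leqNgt ltn_ord mulr0.
rewrite subnn expr0 mulr1 hornerM hornerC horner_exp !hornerE.
move/eqP; rewrite mulf_eq0 signr_eq0 orbF => lead0.
by move: nzP; rewrite -lead_coef_eq0 lead_coefE lead0.
Qed.

(** Transcendence of q carried over from integer to natural coefficients; it makes the polynomial
    defining [Rtilde] unique. *)
Lemma evq_inj : injective evq.
Proof.
move=> p r epr.
have evE (u : {poly nat}) : evq u = (map_poly intr (map_poly Posz u)).[lq].
  rewrite /evq; congr horner; apply/polyP=> k.
  by rewrite !coef_map_id0 // coef_map_id0.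
have /lq_transcendental/eqP :
    (map_poly intr (map_poly Posz p - map_poly Posz r)).[lq] = 0.
  by rewrite rmorphB hornerD hornerN -!evE epr subrr.
rewrite subr_eq0 => /eqP/polyP eP; apply/polyP=> k.
by have := eP k; rewrite !coef_map_id0 // => -[].
Qed.

(** Turns the recursion into a product over positions, where the factor of each chain sits at its
    first element; [b] stands in for the position before 0. *)
Lemma chain_evalE b (c : seq nat) :
  chain_eval b c = \prod_(k < size c)
    ((if (nth 0 c k == 2)%N &&
         ~~ (if nat_of_ord k is k'.+1 then nth 0 c k' == 2 else b)%N
      then Gfib (find (predC1 2%N) (drop k c)) else 1)
     * (if (nth 0 c k == 1)%N then lq else 1)).
Proof.
elim: c b => [|x c IH] b; first by rewrite big_ord0.
rewrite big_ord_recl [LHS]/= IH; congr (_ * _).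
by apply: eq_bigr => -[[|k] lt_k] _.
Qed.

Lemma card_ord_interval (m a b : nat) : (b <= m)%N ->
  #|[set k : 'I_m | (a <= k < b)%N]| = (b - a)%N.
Proof.
move=> bm; rewrite -sum1dep_card -(big_ord_widen_cond m (leq a) (fun=> 1%N) bm).
by rewrite -(big_geq_mkord a b xpredT (fun=> 1%N)) sum_nat_const_nat muln1.
Qed.

(** * Maximal runs of letters that occur twice *)

Section Chains.
Variables (m : nat) (g : 'I_m -> nat) (c : seq nat).
Hypotheses (szc : size c = m) (gE : forall i : 'I_m, nth 0%N c i = g i).
Implicit Types (i j : 'I_m) (d : {set 'I_m}).

Definition run i : nat := find (predC1 2%N) (drop i c).

Definition start i : bool := (nth 0 c i == 2)%N &&
  ~~ (if nat_of_ord i is k.+1 then nth 0 c k == 2 else false)%N.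

Definition chain i : {set 'I_m} := [set j : 'I_m | (i <= j < i + run i)%N].

Definition const2 d := consecutive d && [forall i in d, g i == 2%N].

Lemma run_le i : (i + run i <= m)%N.
Proof.
have := find_size (predC1 2%N) (drop i c); rewrite size_drop szc /run.
by have := ltn_ord i; lia.
Qed.

Lemma card_chain i : #|chain i| = run i.
Proof. by rewrite card_ord_interval ?run_le // addKn. Qed.

Lemma run_gt0 i : start i -> (0 < run i)%N.
Proof.
move=> /andP[c2 _]; rewrite lt0n /run; apply/negP=> /eqP r0.
have : has (predC1 2%N) (drop i c).
  by rewrite has_find r0 size_drop szc subn_gt0.
by move/(nth_find 0%N); rewrite r0 nth_drop addn0 /= c2.
Qed.

Lemma chain_mem i j : j \in chain i -> g j = 2%N.
Proof.
rewrite inE -gE => /andP[ij jr].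
have := @before_find _ 0%N (predC1 2%N) (drop i c) (j - i).
by rewrite nth_drop subnKC //= -/(run i) => /(_ ltac:(lia))/negbFE/eqP.
Qed.

Lemma run_stop i j : j = (i + run i)%N :> nat -> g j <> 2%N.
Proof.
move=> ej; rewrite -gE ej; have jm := ltn_ord j.
have : has (predC1 2%N) (drop i c).
  by rewrite has_find -/(run i) size_drop szc; lia.
by move/(nth_find 0%N); rewrite nth_drop /= => /eqP.
Qed.

Lemma chain_const2 i : start i -> const2 (chain i).
Proof.
move=> si; have r0 := run_gt0 si; have rm := run_le i.
apply/andP; split; last by apply/forall_inP=> j /chain_mem->.
have lt_b : ((i + run i).-1 < m)%N by lia.
apply/existsP; exists i; apply/existsP; exists (Ordinal lt_b) => /=.
apply/andP; split; first by lia.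
by apply/eqP/setP=> j; rewrite !inE; lia.
Qed.

(** An interval of 2s from a cannot pass a + [run a], where the value differs from 2. *)
Lemma const2_chain (a b : 'I_m) d : (a <= b)%N ->
  d = [set i : 'I_m | (a <= i <= b)%N] -> const2 d -> d \subset chain a.
Proof.
move=> ab ed /andP[_ /forall_inP d2]; apply/subsetP=> j.
rewrite ed !inE => /andP[aj jb]; rewrite aj ltnNge; apply/negP=> rj.
have lt_k : (a + run a < m)%N by have := ltn_ord j; lia.
apply: (@run_stop a (Ordinal lt_k)) => //.
by apply/eqP/d2; rewrite ed inE /=; lia.
Qed.

Lemma maxset_chains :
  [set d | maxset const2 d] = [set chain i | i in [set i | start i]].
Proof.
apply/setP=> d; rewrite inE; apply/maxsetP/imsetP=> [[c2 dmax]|[i]].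
  have := c2; rewrite {1}/const2.
  move=> /andP[/existsP[a /existsP[b /andP[ab /eqP ed]]] /forall_inP d2].
  have sub := const2_chain ab ed c2.
  have ga : g a = 2%N by apply/eqP/d2; rewrite ed inE leqnn.
  have sa : start a.
    rewrite /start gE ga /=; case ea : (nat_of_ord a) => [//|k].
    apply/negP=> ck.
    have lt_k : (k < m)%N by have := ltn_ord a; lia.
    (* A 2 just before a would allow this enlargement of [d], against maximality. *)
    pose d' := [set i : 'I_m | (k <= i <= b)%N].
    have dd' : d \subset d' by apply/subsetP=> i; rewrite ed !inE ea; lia.
    have c2' : const2 d'.
      apply/andP; split.
        apply/existsP; exists (Ordinal lt_k); apply/existsP; exists b.
        by rewrite eqxx andbT /=; lia.
      apply/forall_inP=> i; rewrite inE => /andP[ki ib].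
      have [eik|nik] := eqVneq (nat_of_ord i) k; first by rewrite -gE eik.
      by apply: d2; rewrite ed inE ea; lia.
    have := dmax _ c2' dd' => /setP/(_ (Ordinal lt_k)).
    by rewrite ed !inE /= ea; lia.
  by exists a; rewrite ?inE //; apply/esym/dmax => //; apply: chain_const2.
rewrite inE => si -> {d}; split; first exact: chain_const2.
move=> d c2; have := c2; rewrite {1}/const2.
move=> /andP[/existsP[a /existsP[b /andP[ab /eqP ed]]] /forall_inP d2] sub.
have := subsetP sub i; rewrite !inE leqnn -[X in (X < _)%N]addn0 ltn_add2l.
rewrite run_gt0 // => /(_ isT); rewrite ed inE => /andP[ai ib].
(* If the larger interval began before i, position i - 1 would carry a 2, against [start i]. *)
have eai : a = i.
  apply/val_inj/eqP; rewrite eqn_leq ai /= leqNgt; apply/negP=> lt_ai.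
  move: si => /andP[_]; case ei : (nat_of_ord i) => [|k]; first by lia.
  have lt_k : (k < m)%N by have := ltn_ord i; lia.
  move=> /negP[]; rewrite (gE (Ordinal lt_k)).
  by apply: d2; rewrite ed inE /=; lia.
rewrite -ed; apply/eqP; rewrite eqEsubset sub andbT -eai.
exact: const2_chain ab ed c2.
Qed.

Lemma chain_inj : {in [set i | start i] &, injective chain}.
Proof.
move=> i j; rewrite !inE => si sj eij.
have := run_gt0 si; have := run_gt0 sj => rj ri.
have : i \in chain j by rewrite -eij inE; lia.
have : j \in chain i by rewrite eij inE; lia.
by rewrite !inE => h1 h2; apply: val_inj => /=; lia.
Qed.

Lemma prod_chains (R : comNzRingType) (h : nat -> R) :
  \prod_(d in [set d | maxset const2 d]) h #|d| = \prod_(i | start i) h (run i).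
Proof.
rewrite maxset_chains big_imset /=; last exact: chain_inj.
by apply: eq_big => [i|i _]; rewrite ?inE ?card_chain.
Qed.

End Chains.

(** * Passage to polynomials *)

Lemma evq_prod (I : finType) (P : pred I) (F : I -> {poly nat}) :
  evq (\prod_(i | P i) F i) = \prod_(i | P i) evq (F i).
Proof. exact: (big_morph evq evqM evq1). Qed.

Theorem theorem4p5 (n : nat) (v : 'S_n)
    (v321 : avoids321 v) (v2 : two_repeating v) :
  Rtilde 1%g v = 'X^(nocc1 v) * \prod_(c in two_chains v) modFib #|c|.
Proof.
pose c := counts (red_word v) 0 n.-1.
have szc : size c = n.-1 by rewrite size_map size_iota.
have gE (i : 'I_n.-1) : nth 0%N c i = nocc v i.
  by rewrite (nth_map 0%N) ?size_iota // nth_iota.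
have adm : admissible 0 (red_word v).
  split=> // i j ij ci cj.
  exact: (reduced_alternate (red_wordP v) v321 ij ci cj).
have ER : Rpoly 1%g v =
    evq ('X^(nocc1 v) * \prod_(c in two_chains v) modFib #|c|).
  rewrite Rpoly1E -/(Ftrace _) (@Ftrace_counts _ n.-1 0) // -/c chain_evalE.
  rewrite szc big_split /= mulrC evqM evqXn; congr (_ * _).
    rewrite -big_mkcond prodr_const /nocc1; congr (_ ^+ _).
    by apply: eq_card => i; rewrite inE -gE.
  rewrite evq_prod -big_mkcond /=.
  rewrite (prod_chains szc gE (fun k => evq (modFib k))).
  (* Runs at starting positions are nonempty, so the special value of [Gfib] at 0 does not occur. *)
  by apply: eq_bigr => i /(run_gt0 szc); rewrite /run /Gfib; case: find.
(* By [ER] a polynomial with the defining property exists, hence [xget] returns one, and injectivity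
   identifies the two. *)
apply: evq_inj; rewrite -ER; apply/esym.
exact: (@classical_sets.xgetI _ 0 (fun p => Rpoly 1%g v = evq p) _ ER).
Qed.
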